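(* Let $D\subsetneq\mathbb{R}^n$ be a domain and $x,y\in D$. Then $$\frac14\,\delta_D(x,y)\le\tilde\tau_D(x,y)\le\delta_D(x,y).$$ The second inequality is sharp, i.e. there is no constant $C<1$ such that $\tilde\tau_D(x,y)\le C\,\delta_D(x,y)$ for all domains $D\subsetneq\mathbb{R}^n$ and all $x,y\in D$.
   Context: Here $n\ge2$ and a domain is an open connected nonempty set. For $x,y\in D$, $\tilde\tau_D(x,y)=\log\left(1+\sup_{p\in\partial D}\frac{|x-y|}{\sqrt{|x-p||p-y|}}\right)$ with $\partial D$ the boundary in $\mathbb{R}^n$. The Seittenranta metric is $\delta_D(x,y)=\log(1+m_D(x,y))$, where $m_D(x,y)=\sup_{a,b\in\partial D}\frac{|x-y||a-b|}{|x-a||y-b|}$; in this definition the boundary $\partial D$ is taken in $\overline{\mathbb{R}^n}=\mathbb{R}^n\cup\{\infty\}$ (so $\infty\in\partial D$ when $D$ is unbounded), with the usual limiting convention when $a$ or $b$ equals $\infty$: the ratio is $\frac{|x-y|}{|y-b|}$ if $a=\infty\neq b$, $\frac{|x-y|}{|x-a|}$ if $b=\infty\ne a$, and $0$ if $a=b$. *)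

(* Defs.v *)
From HB Require Import structures.
From mathcomp Require Import all_boot all_order all_algebra.
From mathcomp Require Import all_classical all_reals all_analysis.

Set Implicit Arguments.
Unset Strict Implicit.
Unset Printing Implicit Defensive.

Import Order.TTheory GRing.Theory Num.Theory.
Import numFieldNormedType.Exports.

Local Open Scope classical_set_scope.
Local Open Scope ring_scope.

(* The library norm `|v| on row vectors is the max norm.  It induces the same
   topology as the Euclidean norm, so open, connected, closure and interior
   below are the library's. *)
Definition enorm (R : realType) (n : nat) (v : 'rV[R]_n) : R :=
  Num.sqrt (\sum_(i < n) v ord0 i ^+ 2).

Definition edist (R : realType) (n : nat) (x y : 'rV[R]_n) : R :=
  enorm (x - y).

Definition boundary (T : topologicalType) (A : set T) : set T :=
  closure A `\` interior A.

Definition domain (R : realType) (n : nat) (D : set 'rV[R]_n) : Prop :=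
  [/\ open D, connected D & D !=set0].

(* None is the point at infinity. *)
Definition extended_space (R : realType) (n : nat) : topologicalType :=
  one_point_compactification 'rV[R]_n.

Definition extended_boundary (R : realType) (n : nat) (D : set 'rV[R]_n) :
    set (extended_space R n) :=
  @boundary (extended_space R n) (Some @` D).

(* The suprema in [tilde_tau] and [seittenranta_m] are over nonempty sets of
   reals that are bounded above whenever D is a proper subdomain and x, y lie
   in D (both points are at positive distance from the boundary), so the real
   [sup] is never at its default value there. *)
Definition tilde_tau (R : realType) (n : nat) (D : set 'rV[R]_n)
    (x y : 'rV[R]_n) : R :=
  ln (1 + sup [set edist x y / Num.sqrt (edist x p * edist p y)
              | p in boundary D]).

(* Absolute cross-ratio |x-y||a-b| / (|x-a||y-b|), extended by its limits when
   a or b is infinite; for a = b finite the formula already gives 0. *)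
Definition cross_ratio (R : realType) (n : nat) (x y : 'rV[R]_n)
    (a b : option 'rV[R]_n) : R :=
  match a, b with
  | Some p, Some q => edist x y * edist p q / (edist x p * edist y q)
  | None, Some q => edist x y / edist y q
  | Some p, None => edist x y / edist x p
  | None, None => 0
  end.

Definition seittenranta_m (R : realType) (n : nat) (D : set 'rV[R]_n)
    (x y : 'rV[R]_n) : R :=
  sup [set cross_ratio x y a b | a in extended_boundary D
                               & b in extended_boundary D].

Definition seittenranta (R : realType) (n : nat) (D : set 'rV[R]_n)
    (x y : 'rV[R]_n) : R :=
  ln (1 + seittenranta_m D x y).

(* Main.v *)
Require Import Defs.
From HB Require Import structures.
From mathcomp Require Import all_boot all_order all_algebra.
From mathcomp Require Import all_classical all_reals all_analysis.
From mathcomp Require Import ring lra.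

(* Write r = |x-y|, and let T and m be the suprema defining tilde_tau and
   seittenranta.

   Lower bound: |a-b| <= |a-x| + r + |y-b| gives
   1 + |x-y||a-b|/(|x-a||y-b|) <= (1 + r/|x-a|)(1 + r/|y-b|), and each factor
   is at most (1 + T)^2 because |y-a| <= |x-a| + r; hence 1 + m <= (1 + T)^4.

   Upper bound: for p in the boundary, sqrt(|x-p||y-p|) is at least the smaller
   of |x-p| and |y-p|, so it suffices that r/|x-p| <= m.  Take a = p, and b the
   point where the ray from y in the direction away from p leaves D, or infinity
   if D is unbounded: then |p-b| >= |y-b|.

   Sharpness: in the punctured space both quantities equal ln 3 at the points
   x and -x. *)

Set Implicit Arguments.
Unset Strict Implicit.
Unset Printing Implicit Defensive.

Import Order.TTheory GRing.Theory Num.Theory.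
Import numFieldNormedType.Exports.

Local Open Scope classical_set_scope.
Local Open Scope ring_scope.

(* The library has an extended-real [edist] of its own. *)
Local Notation edist := Defs.edist.

(** * The Euclidean norm and its distance on row vectors *)

Section EuclideanNorm.
Variables (R : realType) (n : nat).
Implicit Types (v w x y z : 'rV[R]_n) (t : R).

Lemma enorm_ge0 v : 0 <= enorm v.
Proof. exact: sqrtr_ge0. Qed.

Lemma sqr_enorm v : enorm v ^+ 2 = \sum_(i < n) v ord0 i ^+ 2.
Proof. by rewrite sqr_sqrtr // sumr_ge0 // => i _; exact: sqr_ge0. Qed.

Lemma enormZ t v : enorm (t *: v) = `|t| * enorm v.
Proof.
rewrite /enorm -sqrtr_sqr -sqrtrM ?sqr_ge0 // mulr_sumr.
by congr Num.sqrt; apply: eq_bigr => i _; rewrite mxE exprMn.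
Qed.

Lemma enorm0 : enorm (0 : 'rV[R]_n) = 0.
Proof. by rewrite -(scale0r (0 : 'rV[R]_n)) enormZ normr0 mul0r. Qed.

Lemma enormN v : enorm (- v) = enorm v.
Proof. by rewrite -scaleN1r enormZ normrN1 mul1r. Qed.

Lemma coord_le_enorm v i : `|v ord0 i| <= enorm v.
Proof.
rewrite -sqrtr_sqr ler_sqrt (bigD1 i) //= ?lerDl.
  by apply: sumr_ge0 => j _; exact: sqr_ge0.
by rewrite addr_ge0 ?sqr_ge0 // sumr_ge0 // => j _; exact: sqr_ge0.
Qed.

(** Links the Euclidean distance to the library topology: a Euclidean ball lies in the max-norm ball
    of the same radius. *)
Lemma norm_le_enorm v : `|v| <= enorm v.
Proof.
rewrite -[X in X <= _]/(mx_norm v) mx_normrE.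
apply: bigmax_le => [|[i j] _ /=]; first exact: enorm_ge0.
by rewrite ord1 coord_le_enorm.
Qed.

Lemma enorm_gt0 v : (0 < enorm v) = (v != 0).
Proof.
apply/idP/idP => [|v0].
  by apply: contraTneq => ->; rewrite enorm0 ltxx.
by rewrite (lt_le_trans _ (norm_le_enorm v)) ?normr_gt0.
Qed.

(** Cauchy-Schwarz, from expanding the nonnegative square of the Euclidean norm of [|w|^2 v - c w],
    where [c] is the dot product; this equals [|w|^2 (|v|^2 |w|^2 - c^2)]. *)
Lemma dot_le_enorm v w :
  \sum_(i < n) v ord0 i * w ord0 i <= enorm v * enorm w.
Proof.
set c := \sum_(i < n) _.
have [w0|w0] := eqVneq w 0.
  rewrite /c big1 ?mulr_ge0 ?enorm_ge0 // => i _.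
  by rewrite w0 mxE mulr0.
have b0 : 0 < enorm w by rewrite enorm_gt0.
have : 0 <= \sum_(i < n) (enorm w ^+ 2 * v ord0 i - c * w ord0 i) ^+ 2.
  by apply: sumr_ge0 => i _; exact: sqr_ge0.
have -> : \sum_(i < n) (enorm w ^+ 2 * v ord0 i - c * w ord0 i) ^+ 2 =
    enorm w ^+ 2 * ((enorm v * enorm w) ^+ 2 - c ^+ 2).
  transitivity (\sum_(i < n) (enorm w ^+ 4 * v ord0 i ^+ 2 -
      2 * enorm w ^+ 2 * c * (v ord0 i * w ord0 i) + c ^+ 2 * w ord0 i ^+ 2)).
    by apply: eq_bigr => i _; ring.
  rewrite big_split /= sumrB -!mulr_sumr -!sqr_enorm -/c; ring.
rewrite pmulr_rge0 ?exprn_gt0 // subr_ge0 => cvw.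
apply: le_trans (ler_norm c) _.
rewrite -ler_sqr ?nnegrE ?mulr_ge0 ?enorm_ge0 //.
by rewrite real_normK ?num_real.
Qed.

Lemma ler_enormD v w : enorm (v + w) <= enorm v + enorm w.
Proof.
rewrite -(@ler_pXn2r _ 2) ?nnegrE ?addr_ge0 ?enorm_ge0 //.
have -> : enorm (v + w) ^+ 2 =
    enorm v ^+ 2 + 2 * (\sum_(i < n) v ord0 i * w ord0 i) + enorm w ^+ 2.
  rewrite !sqr_enorm mulr_sumr -!big_split.
  by apply: eq_bigr => i _; rewrite /= mxE; ring.
have := dot_le_enorm v w; lra.
Qed.

Lemma edist_sym x y : edist x y = edist y x.
Proof. by rewrite /edist -opprB enormN. Qed.

Lemma edist_ge0 x y : 0 <= edist x y.
Proof. exact: enorm_ge0. Qed.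

Lemma edist_gt0 x y : (0 < edist x y) = (x != y).
Proof. by rewrite /edist enorm_gt0 subr_eq0. Qed.

Lemma edist_triangle y x z : edist x z <= edist x y + edist y z.
Proof.
by rewrite /edist (_ : x - z = x - y + (y - z)) ?ler_enormD // addrA subrK.
Qed.

End EuclideanNorm.

(** * Boundaries in the space and in its one-point compactification *)

Section Boundary.
Variable (R : realType).

Lemma connected_meets_boundary (T : topologicalType) (A D : set T) :
  connected A -> A `&` D !=set0 -> ~ A `<=` D -> A `&` boundary D !=set0.
Proof.
move=> cA [x [Ax Dx]] AD; apply: contrapT => AB.
have sub z : A z -> (D° `|` ~` closure D) z.
  move=> Az; have [iz|niz] := pselect (D° z); first by left.
  by right => cz; apply: AB; exists z; split.
have sep : separated D° (~` closure D).
  split; apply/seteqP; split => // z [].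
    by move=> cz; apply; exact: (closureS (@interior_subset _ D)).
  move=> iz; rewrite -interiorC => /(closureS (@interior_subset _ (~` D))).
  by rewrite closure_setC; apply.
have [AiD|AcD] := connected_subset sep sub cA.
  by apply: AD; apply: subset_trans AiD _; exact: interior_subset.
exact: (AcD _ Ax) (subset_closure Dx).
Qed.

Lemma segment_continuous n (x v : 'rV[R]_n) :
  continuous (fun t : R => x + t *: v).
Proof.
by move=> t; apply: cvgD; [exact: cvg_cst|apply: cvgZr_tmp; exact: cvg_id].
Qed.

Lemma connected_line_segment n (x v : 'rV[R]_n) :
  connected [set x + t *: v | t in `[0, 1 : R]].
Proof.
apply: connected_continuous_connected (@segment_connected R 0 1) _.
exact/continuous_subspaceT/segment_continuous.
Qed.

Lemma segment_meets_boundary n (D : set 'rV[R]_n) (x v : 'rV[R]_n) :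
  D x -> ~ D (x + v) -> exists2 t : R, 0 <= t <= 1 & boundary D (x + t *: v).
Proof.
move=> Dx Dxv.
have [| |_ [[t /= t01 <-] bt]] :=
    connected_meets_boundary (@connected_line_segment n x v) (D := D).
- exists x; split=> //; exists 0; rewrite ?scale0r ?addr0 //=.
  by rewrite in_itv /= lexx ler01.
- move=> sub; apply: Dxv; apply: sub; exists 1; rewrite ?scale1r //=.
  by rewrite in_itv /= ler01 lexx.
by exists t; rewrite // in_itv in t01.
Qed.

Lemma boundary_notin (T : topologicalType) (D : set T) p :
  open D -> boundary D p -> ~ D p.
Proof. by move=> /interior_id {2}<- []. Qed.

Lemma open_boundary_far n (D : set 'rV[R]_n) x :
  open D -> D x -> exists2 d : R, 0 < d &
    forall p, boundary D p -> d <= edist x p.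
Proof.
move=> oD Dx.
have /nbhs_ballP[d /= d0 dD] : nbhs x D by exact: open_nbhs_nbhs.
exists d => // p bp; rewrite leNgt; apply/negP => xp.
apply: (boundary_notin oD bp); apply: dD; rewrite -ball_normE /=.
exact: le_lt_trans (norm_le_enorm _) xp.
Qed.

(** A set is a neighbourhood of a finite point in the compactification exactly when its preimage
    under [Some] is one, so interior and closure agree there. *)
Lemma extended_boundary_Some n (D : set 'rV[R]_n) p :
  extended_boundary D (Some p) <-> boundary D p.
Proof.
have intE : @interior (extended_space R n) (Some @` D) (Some p) <-> D° p.
  split=> [h|]; last exact: one_point_compactification_some_nbhs.
  have {}h : nbhs p (Some @^-1` (Some @` D)) := h.
  by apply: filterS h => z [z' Dz' [<-]].
have clE : @closure (extended_space R n) (Some @` D) (Some p) <-> closure D p.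
  split=> cl U.
    move=> /one_point_compactification_some_nbhs /cl.
    move=> [_ [[z Dz <-] [z' Uz' [zz']]]].
    by exists z; split=> //; rewrite -zz'.
  move=> pU; have {}pU : nbhs p (Some @^-1` U) := pU.
  have [z [Dz Uz]] := cl _ pU.
  by exists (Some z); split=> //; exists z.
by split=> -[/clE cl ni]; split=> // /intE.
Qed.

(** A neighbourhood of infinity contains the complement of a compact [K]; as [K] is bounded, an
    unbounded [D] has a point outside it. *)
Lemma extended_boundary_infty n (D : set 'rV[R]_n) :
  ~ bounded_set D -> extended_boundary D None.
Proof.
move=> nbD; split; last by move=> /interior_subset [].
move=> U [K [cK _] KU].
have [z [Dz Kz]] : exists z, D z /\ ~ K z.
  apply: contrapT => DK; apply: nbD.
  have [M [Mreal KM]] := compact_bounded cK.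
  exists M; split=> // N MN z Dz; apply: (KM N MN).
  by apply: contrapT => Kz; apply: DK; exists z.
by exists (Some z); split; [exists z|apply: KU; left; exists z].
Qed.

Lemma ray_meets_boundary n (D : set 'rV[R]_n) (x v : 'rV[R]_n) :
  open D -> bounded_set D -> D x -> v != 0 ->
  exists2 t : R, 0 < t & boundary D (x + t *: v).
Proof.
move=> oD [M [_ DM]] Dx v0.
have nv0 : 0 < `|v| by rewrite normr_gt0.
pose N := Num.max M 0 + 1; pose T := (N + `|x| + 1) / `|v|.
(* [T] makes [T *: v] of norm [N + |x| + 1], so [x + T *: v] has norm at least [N + 1] and is
   outside [D]. The maximum with 0 is there because the bound [M] may be negative. *)
have N0 : 0 < N by rewrite ltr_wpDl // le_max lexx orbT.
have MN : M < N by rewrite ltr_pwDr // le_max lexx.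
have T0 : 0 <= T by rewrite divr_ge0 // addr_ge0 // addr_ge0 // ltW.
have : ~ D (x + T *: v).
  move=> /(DM N MN); apply/negP; rewrite -ltNge.
  have := ler_normB (x + T *: v) x.
  rewrite addrAC subrr add0r normrZ ger0_norm // /T divfK ?gt_eqF //; lra.
move=> /(segment_meets_boundary Dx)[t /andP[t0 _]]; rewrite scalerA => bt.
exists (t * T) => //; rewrite lt_def mulr_ge0 // andbT.
(* A zero parameter would put [x] itself on the boundary of the open set [D]. *)
apply/eqP => tT0; apply: boundary_notin oD bt _.
by rewrite tT0 scale0r addr0.
Qed.

End Boundary.

(** * Suprema of sets of reals *)

Section RealSup.
Variable R : realType.
Implicit Types (A : set R) (M : R).

(* [sup] is 0 on the empty set and on unbounded sets, whence the two sign
   conditions. *)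
Lemma ge0_sup_le A M : 0 <= M -> ubound A M -> sup A <= M.
Proof.
move=> M0 AM; have [->|/set0P A0] := eqVneq A set0; first by rewrite sup0.
exact: ge_sup.
Qed.

Lemma sup_ge0 A : (forall a, A a -> 0 <= a) -> 0 <= sup A.
Proof.
move=> A0; have [sA|nsA] := pselect (has_sup A); last by rewrite sup_out.
have [[a Aa] ubA] := sA.
by apply: le_trans (A0 _ Aa) _; exact: ub_le_sup.
Qed.

End RealSup.

(** * The two inequalities between the suprema, then between their logarithms *)

Section Comparison.
Variables (R : realType) (n : nat).
Implicit Types (D : set 'rV[R]_n) (x y p q : 'rV[R]_n).

Definition tilde_tau_sup D x y : R :=
  sup [set edist x y / Num.sqrt (edist x p * edist p y) | p in boundary D].

Lemma tilde_tau_sup_ge0 D x y : 0 <= tilde_tau_sup D x y.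
Proof.
by apply: sup_ge0 => _ [p _ <-]; rewrite divr_ge0 ?edist_ge0 ?sqrtr_ge0.
Qed.

(** The supremum is genuine: if [x] and [y] are at distances at least [d] and [e] from the boundary,
    every ratio is at most [|x-y| / sqrt (d * e)]. *)
Lemma le_tilde_tau_sup D x y p : open D -> D x -> D y -> boundary D p ->
  edist x y / Num.sqrt (edist x p * edist p y) <= tilde_tau_sup D x y.
Proof.
move=> oD Dx Dy bp.
have [d d0 dx] := open_boundary_far oD Dx.
have [e e0 ey] := open_boundary_far oD Dy.
apply: ub_le_sup; last by exists p.
exists (edist x y / Num.sqrt (d * e)) => _ [q bq <-].
have dx' := dx _ bq; have ey' := ey _ bq; rewrite [edist y q]edist_sym in ey'.
have x0 := lt_le_trans d0 dx'; have y0 := lt_le_trans e0 ey'.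
rewrite ler_wpM2l ?edist_ge0 // lef_pV2 ?posrE ?sqrtr_gt0 ?mulr_gt0 //.
by rewrite ler_wsqrtr // ler_pM // ltW.
Qed.

Lemma cross_ratio_ge0 x y a b : 0 <= cross_ratio x y a b.
Proof.
by case: a b => [p|] [q|] //=; rewrite ?divr_ge0 ?mulr_ge0 ?edist_ge0.
Qed.

(** Transfers an estimate centred at [x] to one centred at [y]. *)
Lemma cross_ratio_swap x y a b : cross_ratio y x a b = cross_ratio x y b a.
Proof.
case: a b => [p|] [q|] //=; rewrite [edist y x]edist_sym //.
by rewrite [edist p q]edist_sym [edist y p * _]mulrC.
Qed.

(* With [v = sqrt (1 + r / s)] the hypothesis gives [T >= v - 1 / v], and
   [v >= 1]. *)
Lemma one_plus_ratio_le (r s s' T : R) :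
  0 <= r -> 0 < s -> 0 < s' -> s' <= s + r -> r / Num.sqrt (s * s') <= T ->
  1 + r / s <= (1 + T) ^+ 2.
Proof.
move=> r0 s0 s'0 s's rT; set v := Num.sqrt (1 + r / s).
have rs0 : 0 <= r / s by rewrite divr_ge0 // ltW.
have v2 : v ^+ 2 = 1 + r / s by rewrite sqr_sqrtr // addr_ge0.
have v1 : 1 <= v.
  by rewrite -[leLHS]sqrtr1 ler_wsqrtr // lerDl.
have v0 : 0 < v := lt_le_trans ltr01 v1.
have svE : Num.sqrt (s * (s + r)) = s * v.
  have -> : s * (s + r) = (s * v) ^+ 2 by rewrite exprMn v2; field; lra.
  by rewrite sqrtr_sqr ger0_norm // mulr_ge0 // ltW.
have vT : v - v^-1 <= T.
  apply: le_trans rT.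
  have -> : v - v^-1 = r / (s * v).
    have -> : r = s * (v ^+ 2 - 1) by rewrite v2; field; lra.
    by field; rewrite !gt_eqF.
  rewrite ler_wpM2l // lef_pV2 ?posrE ?sqrtr_gt0 ?mulr_gt0 //.
  by rewrite -svE ler_wsqrtr // ler_pM2l.
have vV : v^-1 <= 1 by rewrite invf_le1.
by rewrite -v2 ler_sqr ?nnegrE; lra.
Qed.

Lemma one_plus_edist_ratio_le D x y p :
  open D -> D x -> D y -> boundary D p ->
  1 + edist x y / edist x p <= (1 + tilde_tau_sup D x y) ^+ 2.
Proof.
move=> oD Dx Dy bp; have nDp := boundary_notin oD bp.
have xp : 0 < edist x p
  by rewrite edist_gt0; apply/eqP => xp; apply: nDp; rewrite -xp.
have py : 0 < edist p y
  by rewrite edist_gt0; apply/eqP => py; apply: nDp; rewrite py.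
apply: one_plus_ratio_le (le_tilde_tau_sup oD Dx Dy bp) => //.
  exact: edist_ge0.
by rewrite [edist x p]edist_sym; exact: edist_triangle.
Qed.

Lemma tilde_tau_sup_sym D x y : tilde_tau_sup D y x = tilde_tau_sup D x y.
Proof.
congr sup; apply: eq_imagel => p _.
rewrite [edist y x]edist_sym [edist y p]edist_sym [edist p x]edist_sym.
by rewrite [edist p y * _]mulrC.
Qed.

(** Besides giving the lower bound of the theorem, this shows that the cross-ratios are bounded
    above, so that each of them is at most [seittenranta_m]. *)
Lemma cross_ratio_le D x y a b : open D -> D x -> D y ->
  extended_boundary D a -> extended_boundary D b ->
  1 + cross_ratio x y a b <= (1 + tilde_tau_sup D x y) ^+ 4.
Proof.
move=> oD Dx Dy; set T := tilde_tau_sup D x y.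
have T1 : 1 <= 1 + T by rewrite lerDl tilde_tau_sup_ge0.
have T24 : (1 + T) ^+ 2 <= (1 + T) ^+ 4 by rewrite ler_weXn2l.
have boundx p : extended_boundary D (Some p) ->
    1 + edist x y / edist x p <= (1 + T) ^+ 2.
  by move=> /extended_boundary_Some; exact: one_plus_edist_ratio_le.
have boundy p : extended_boundary D (Some p) ->
    1 + edist x y / edist y p <= (1 + T) ^+ 2.
  move=> /extended_boundary_Some.
  rewrite /T -tilde_tau_sup_sym [edist x y]edist_sym.
  exact: one_plus_edist_ratio_le.
case: a b => [p|] [q|] bp bq /=.
- have nD z w : D z -> extended_boundary D (Some w) -> 0 < edist z w.
    move=> Dz /extended_boundary_Some bw; rewrite edist_gt0.
    by apply/eqP => zw; apply: (boundary_notin oD bw); rewrite -zw.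
  have xp := nD _ _ Dx bp; have yq := nD _ _ Dy bq.
  have -> : (1 + T) ^+ 4 = (1 + T) ^+ 2 * (1 + T) ^+ 2 by rewrite -exprD.
  apply: le_trans (ler_pM _ _ (boundx _ bp) (boundy _ bq));
    rewrite ?addr_ge0 ?divr_ge0 ?edist_ge0 //.
  have pq : edist p q <= edist x p + edist x y + edist y q.
    apply: le_trans (edist_triangle y p q) _; rewrite lerD2r.
    by rewrite [edist x p]edist_sym; exact: edist_triangle.
  have -> : (1 + edist x y / edist x p) * (1 + edist x y / edist y q) =
      1 + edist x y * (edist x p + edist x y + edist y q) /
        (edist x p * edist y q) by field; rewrite !gt_eqF.
  rewrite lerD2l ler_wpM2r ?invr_ge0 ?mulr_ge0 ?edist_ge0 //.
  by rewrite ler_wpM2l ?edist_ge0.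
(* When one point is infinite a single factor remains, already at most [(1 + T) ^+ 2]. *)
- exact: le_trans (boundx _ bp) T24.
- exact: le_trans (boundy _ bq) T24.
- by rewrite addr0; exact: exprn_ege1.
Qed.

Lemma seittenranta_m_ge0 D x y : 0 <= seittenranta_m D x y.
Proof. by apply: sup_ge0 => _ [a _ [b _ <-]]; exact: cross_ratio_ge0. Qed.

Lemma seittenranta_m_le D x y : open D -> D x -> D y ->
  1 + seittenranta_m D x y <= (1 + tilde_tau_sup D x y) ^+ 4.
Proof.
move=> oD Dx Dy; rewrite -lerBrDl; apply: ge0_sup_le.
  by rewrite subr_ge0 exprn_ege1 // lerDl tilde_tau_sup_ge0.
by move=> _ [a ba [b bb <-]]; rewrite lerBrDl; exact: cross_ratio_le.
Qed.

Lemma le_seittenranta_m D x y a b : open D -> D x -> D y ->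
  extended_boundary D a -> extended_boundary D b ->
  cross_ratio x y a b <= seittenranta_m D x y.
Proof.
move=> oD Dx Dy ba bb; apply: ub_le_sup; last by exists a => //; exists b.
exists ((1 + tilde_tau_sup D x y) ^+ 4 - 1) => _ [c bc [e be <-]].
by rewrite lerBrDl; exact: cross_ratio_le.
Qed.

(** For unbounded [D], [b] at infinity gives equality. Otherwise [b = y + t (y-p)] with [t > 0], and
    [|p-b| / |y-b| = 1 + 1/t] exceeds 1. *)
Lemma exists_large_cross_ratio D x y p : open D -> D y -> boundary D p ->
  exists2 b, extended_boundary D b &
    edist x y / edist x p <= cross_ratio x y (Some p) b.
Proof.
move=> oD Dy bp; have [bD|/extended_boundary_infty] := pselect (bounded_set D);
  last by exists None.
have yp : y != p by apply/eqP => yp; apply: (boundary_notin oD bp); rewrite -yp.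
have [t t0 bt] : exists2 t : R, 0 < t & boundary D (y + t *: (y - p)).
  by apply: ray_meets_boundary => //; rewrite subr_eq0.
exists (Some (y + t *: (y - p))); first exact/extended_boundary_Some.
rewrite /= /edist.
have -> : y - (y + t *: (y - p)) = (- t) *: (y - p).
  by rewrite opprD addNKr scaleNr.
have -> : p - (y + t *: (y - p)) = (- (1 + t)) *: (y - p).
  by rewrite scaleNr scalerDl scale1r opprD [in RHS]opprD opprB addrA.
rewrite !enormZ !normrN !gtr0_norm ?addr_gt0 //.
have e0 : 0 < enorm (y - p) by rewrite enorm_gt0 subr_eq0.
have -> : enorm (x - y) * ((1 + t) * enorm (y - p)) /
    (enorm (x - p) * (t * enorm (y - p))) =
    enorm (x - y) / enorm (x - p) * (1 + t^-1).
  (* Nothing here excludes [x = p], so the inverse of [|x-p|] is generalized before [field]. *)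
  by rewrite !invfM; move: (enorm (x - p))^-1 => X; field; rewrite !gt_eqF.
by rewrite ler_peMr ?divr_ge0 ?enorm_ge0 // lerDl invr_ge0 ltW.
Qed.

Lemma edist_ratio_le_seittenranta_m D x y p :
  open D -> D x -> D y -> boundary D p ->
  edist x y / edist x p <= seittenranta_m D x y /\
  edist x y / edist y p <= seittenranta_m D x y.
Proof.
move=> oD Dx Dy bp; have bep := (extended_boundary_Some D p).2 bp; split.
  have [b bb /le_trans] := exists_large_cross_ratio x oD Dy bp.
  by apply; exact: le_seittenranta_m.
(* The same choice with [x] and [y] exchanged; after the swap [p] is the second boundary point. *)
have [b bb] := exists_large_cross_ratio y oD Dx bp.
rewrite cross_ratio_swap [edist y x]edist_sym => /le_trans.
by apply; exact: le_seittenranta_m.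
Qed.

Lemma tilde_tau_sup_le D x y : open D -> D x -> D y ->
  tilde_tau_sup D x y <= seittenranta_m D x y.
Proof.
move=> oD Dx Dy; apply: ge0_sup_le; first exact: seittenranta_m_ge0.
move=> _ [p bp <-]; have nDp := boundary_notin oD bp.
have xp : 0 < edist x p
  by rewrite edist_gt0; apply/eqP => xp; apply: nDp; rewrite -xp.
have yp : 0 < edist y p
  by rewrite edist_gt0; apply/eqP => yp; apply: nDp; rewrite -yp.
have [mx my] := edist_ratio_le_seittenranta_m oD Dx Dy bp.
rewrite [edist p y]edist_sym.
have sqrtV_le (s u : R) : 0 < s -> s <= u -> (Num.sqrt (s * u))^-1 <= s^-1.
  move=> s0 su; have u0 := lt_le_trans s0 su.
  rewrite lef_pV2 ?posrE ?sqrtr_gt0 ?mulr_gt0 //.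
  by rewrite -[leLHS]gtr0_norm // -sqrtr_sqr ler_wsqrtr // expr2 ler_pM2l.
have [xy|/ltW yx] := leP (edist x p) (edist y p).
  by apply: le_trans mx; rewrite ler_wpM2l ?edist_ge0 ?sqrtV_le.
apply: le_trans my; rewrite ler_wpM2l ?edist_ge0 //.
by rewrite mulrC sqrtV_le.
Qed.

Lemma tilde_tau_le_seittenranta D x y : open D -> D x -> D y ->
  tilde_tau D x y <= seittenranta D x y.
Proof.
move=> oD Dx Dy; rewrite /tilde_tau /seittenranta -/(tilde_tau_sup D x y).
rewrite ler_ln ?posrE ?ltr_wpDr ?tilde_tau_sup_ge0 ?seittenranta_m_ge0 //.
by rewrite lerD2l tilde_tau_sup_le.
Qed.

Lemma seittenranta_le_tilde_tau D x y : open D -> D x -> D y ->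
  seittenranta D x y <= 4 * tilde_tau D x y.
Proof.
move=> oD Dx Dy; rewrite /tilde_tau /seittenranta -/(tilde_tau_sup D x y).
have T0 : 0 < 1 + tilde_tau_sup D x y by rewrite ltr_wpDr ?tilde_tau_sup_ge0.
have m0 : 0 < 1 + seittenranta_m D x y by rewrite ltr_wpDr ?seittenranta_m_ge0.
rewrite mulr_natl -lnXn // ler_ln ?posrE ?exprn_gt0 //.
exact: seittenranta_m_le.
Qed.

End Comparison.

(** * The punctured space as extremal domain *)

Section PuncturedSpace.
Variables (R : realType) (n : nat).
Implicit Types x y : 'rV[R]_n.

Definition punctured_space : set 'rV[R]_n := ~` [set 0].

Lemma open_punctured_space : open punctured_space.
Proof.
apply: closed_openC; apply: compact_closed; last exact: compact_set1.
exact: norm_hausdorff.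
Qed.

(* The segment from [x] to [y] stays in a half-space missing the origin. *)
Lemma punctured_space_component x y (k : 'I_n) :
  0 < x ord0 k * y ord0 k -> connected_component punctured_space x y.
Proof.
move=> xyk; apply: (@connected_component_max _ punctured_space
  [set x + t *: (y - x) | t in `[0, 1 : R]] x).
- by exists 0; rewrite ?scale0r ?addr0 //= in_itv /= lexx ler01.
- move=> _ [t /= + <-]; rewrite in_itv /= => /andP[t0 t1] /rowP /(_ k).
  rewrite !mxE; set a := x _ _ in xyk *; set b := y _ _ in xyk * => ab0.
  have a2 : 0 < a ^+ 2.
    rewrite exprn_even_gt0 //=.
    by apply: contraTneq xyk => ->; rewrite mul0r ltxx.
  (* Multiplied by [a], the coordinate becomes [(1 - t) a^2 + t a b]: it is [a^2 > 0] at [t = 0],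
     and for [t > 0] its second term is positive. *)
  have : a * (a + t * (b - a)) = 0 by rewrite ab0 mulr0.
  have [t_0|tn0] := eqVneq t 0; first by rewrite t_0; nra.
  have tp : 0 < t by rewrite lt_neqAle eq_sym tn0.
  have := mulr_gt0 tp xyk; have : 0 <= (1 - t) * a ^+ 2.
    by rewrite mulr_ge0 ?subr_ge0 // ltW.
  nra.
- exact: connected_line_segment.
- by exists 1; rewrite ?scale1r ?subrKC //= in_itv /= lexx ler01.
Qed.

(** Every [z] is joined to the all-ones vector [c]: directly if its chosen nonzero coordinate [k] is
    positive, otherwise through [u], which is -1 at [k] and 1 elsewhere. Here [u] shares the sign of
    [z] at [k] and that of [c] at some [j != k], which exists since [n >= 2]. *)
Lemma connected_punctured_space : (2 <= n)%N -> connected punctured_space.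
Proof.
move=> n2; pose c : 'rV[R]_n := const_mx 1.
have pc : punctured_space c.
  move=> /rowP /(_ (Ordinal (ltnW n2))); rewrite !mxE; exact/eqP/oner_neq0.
suff -> : punctured_space = connected_component punctured_space c.
  exact: component_connected.
apply/seteqP; split; last exact: connected_component_sub.
move=> z /eqP /rV0Pn[k zk].
have [zk0|zk0] := ltP 0 (z ord0 k).
  by apply: (@punctured_space_component _ _ k); rewrite mxE mul1r.
have {}zk0 : z ord0 k < 0 by rewrite lt_neqAle zk.
have [j jk] : exists j : 'I_n, j != k.
  have [k0|k0] := eqVneq (k : nat) 0.
    by exists (Ordinal n2); rewrite -val_eqE /= k0.
  by exists (Ordinal (ltnW n2)); rewrite -val_eqE /= eq_sym.
pose u : 'rV[R]_n := \row_i (if i == k then -1 else 1).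
apply: (@connected_component_trans _ _ u).
  apply: (@punctured_space_component _ _ j).
  by rewrite !mxE (negbTE jk) mulr1.
apply: (@punctured_space_component _ _ k).
by rewrite mxE eqxx mulN1r oppr_gt0.
Qed.

Lemma boundary_punctured_space (e : 'rV[R]_n) : e != 0 ->
  boundary punctured_space = [set 0].
Proof.
move=> /eqP e0; have sub : boundary punctured_space `<=` [set 0].
  by move=> p /(boundary_notin open_punctured_space) /contrapT.
apply/seteqP; split=> // _ ->.
(* The segment from [e] to the origin leaves the space, so it meets the boundary, and only the
   origin can be there. *)
have [|t _ bt] := @segment_meets_boundary _ _ punctured_space e (- e) e0.
  by rewrite subrr; exact.
by rewrite -[X in boundary _ X](sub _ bt).
Qed.

(** The extended boundary has no points other than 0 and infinity: equal points give ratio 0,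
    distinct ones give [2|e| / |e|]. *)
Lemma seittenranta_m_punctured_space (e : 'rV[R]_n) : e != 0 ->
  seittenranta_m punctured_space e (- e) <= 2.
Proof.
move=> e0; have ee : edist e (- e) = 2 * enorm e.
  by rewrite /edist opprK -mulr2n -scaler_nat enormZ ger0_norm.
have ne0 : enorm e != 0 by rewrite gt_eqF // enorm_gt0.
apply: ge0_sup_le => // _ [a ba [b bb <-]].
have Some0 p : extended_boundary punctured_space (Some p) -> p = 0.
  by move=> /extended_boundary_Some; rewrite (boundary_punctured_space e0).
case: a b ba bb => [p|] [q|] //=
  => [/Some0 -> /Some0 ->|/Some0 -> _|_ /Some0 ->].
- by rewrite {2}/edist subr0 enorm0 mulr0 mul0r.
- by rewrite ee /edist subr0 mulfK.
- by rewrite ee /edist subr0 enormN mulfK.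
Qed.

Lemma tilde_tau_sup_punctured_space (e : 'rV[R]_n) : e != 0 ->
  2 <= tilde_tau_sup punctured_space e (- e).
Proof.
move=> e0.
have := @le_tilde_tau_sup _ _ punctured_space e (- e) 0 open_punctured_space.
rewrite (boundary_punctured_space e0) => /(_ _ _ erefl).
rewrite /edist opprK subr0 add0r -mulr2n -scaler_nat enormZ ger0_norm //.
rewrite -expr2 sqrtr_sqr ger0_norm ?enorm_ge0 // mulfK ?gt_eqF ?enorm_gt0 //.
by apply; apply/eqP; rewrite ?oppr_eq0.
Qed.

End PuncturedSpace.

Arguments punctured_space {R n}.

Theorem theorem5p3 (R : realType) (n : nat) (hn : (2 <= n)%N) :
  (forall (D : set 'rV[R]_n) (x y : 'rV[R]_n),
     domain D -> D != setT -> D x -> D y ->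
     4^-1 * seittenranta D x y <= tilde_tau D x y /\
     tilde_tau D x y <= seittenranta D x y) /\
  ~ (exists C : R, C < 1 /\
       forall (D : set 'rV[R]_n) (x y : 'rV[R]_n),
         domain D -> D != setT -> D x -> D y ->
         tilde_tau D x y <= C * seittenranta D x y).
Proof.
split=> [D x y [oD _ _] _ Dx Dy|[C [C1 tauC]]].
  split; last exact: tilde_tau_le_seittenranta.
  by rewrite mulrC ler_pdivrMr // mulrC seittenranta_le_tilde_tau.
pose e : 'rV[R]_n := const_mx 1.
have e0 : e != 0.
  by apply/rV0Pn; exists (Ordinal (ltnW hn)); rewrite mxE oner_neq0.
have De : punctured_space e by exact/eqP.
have DNe : punctured_space (- e) by apply/eqP; rewrite oppr_eq0.
have dD : domain (punctured_space : set 'rV[R]_n).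
  split; [exact: open_punctured_space| |by exists e].
  exact: connected_punctured_space.
have DT : (punctured_space : set 'rV[R]_n) != setT.
  by apply/eqP => DT; have : punctured_space (0 : 'rV[R]_n); [rewrite DT|apply].
have tau3 : ln 3 <= tilde_tau punctured_space e (- e).
  rewrite ler_ln ?posrE ?ltr_wpDr ?tilde_tau_sup_ge0 //.
  have := tilde_tau_sup_punctured_space e0; rewrite /tilde_tau_sup; lra.
have delta3 : seittenranta punctured_space e (- e) <= ln 3.
  rewrite ler_ln ?posrE ?ltr_wpDr ?seittenranta_m_ge0 //.
  have := seittenranta_m_punctured_space e0; lra.
have ln3 : 0 < ln (3 : R) by rewrite ln_gt0 // ltr1n.
(* The upper bound makes [delta >= tau >= ln 3] positive, whatever the sign of [C]; then [delta <=
   ln 3 <= tau <= C * delta < delta], a contradiction. *)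
have tau_delta := tilde_tau_le_seittenranta (@open_punctured_space R n) De DNe.
have := tauC _ _ _ dD DT De DNe; nra.
Qed.
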